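(* Let $A,B\in\mathbb{R}^{m\times n}$, $c\in\mathbb{R}^m$, and let $\{w^k\}_{k=0}^\infty\subseteq\mathbb{R}^n\times\mathbb{R}^n$ be any sequence satisfying $w^{k+1}\in(P_{C_1}\circ P_{C_2})(w^k)$ for all $k\ge0$. Suppose $w^*=(u^*,v^* )\in C_1\cap C_2$, and denote $$I_1^*:=\{i:u_i^*>v_i^*=0\},\qquad I_2^*:=\{i:0=u_i^*<v_i^*\},$$ $$\Gamma^*:=\{w=(u,v)\in\mathbb{R}^n\times\mathbb{R}^n:(u_i,v_i)\in K_j\text{ whenever } i\in I_j^*,\ j=1,2\}.$$ If $w^k\in\Gamma^*$ for all sufficiently large $k$, then $\Psi(w^k)\to0$ as $k\to\infty$. Moreover, there exists a point $\bar w\in C_1\cap C_2$ such that $w^k\to\bar w$ as $k\to\infty$.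
   Context: $K_1:=\{(a,b)\in\mathbb{R}^2:a>b\text{ or }a=b\le0\}$ and $K_2:=\{(a,b)\in\mathbb{R}^2:a<b\text{ or }a=b\le0\}$. $\Psi(w):=\sum_{i=1}^n\psi(u_i,v_i)$ for $w=(u,v)\in\mathbb{R}^n\times\mathbb{R}^n$, where $\psi(s,t)=\tfrac12\min(s,t)^2+\tfrac12\max(-\max(s,t),0)^2$. With $T=[\,A+B\;\;\;-A+B\,]\in\mathbb{R}^{m\times 2n}$, $C_1:=\{w\in\mathbb{R}^n\times\mathbb{R}^n: Tw=\sqrt2\,c\}$ and $C_2:=\{w=(u,v)\in\mathbb{R}^n\times\mathbb{R}^n: u\ge 0,\ v\ge 0,\ \langle u,v\rangle=0\}$ (inequalities componentwise). For a set $S$, $P_S(z):=\{s\in S:\|s-z\|\le\|t-z\|\ \forall t\in S\}$ is the (possibly multivalued) Euclidean metric projector, and $(P_{C_1}\circ P_{C_2})(w)=\bigcup_{w'\in P_{C_2}(w)}P_{C_1}(w')$. *)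

(* Defs.v *)
From mathcomp Require Import all_boot all_order all_algebra.
From mathcomp Require Import all_classical all_reals all_analysis.

Set Implicit Arguments.
Unset Strict Implicit.
Unset Printing Implicit Defensive.

Import Order.TTheory GRing.Theory Num.Theory.
Import numFieldNormedType.Exports.

Local Open Scope classical_set_scope.
Local Open Scope ring_scope.

(* A point w = (u, v) of R^n x R^n is the stacked column vector w : 'cV_(n + n)
   with u = usubmx w and v = dsubmx w. *)

Definition dot {R : realType} {p : nat} (x y : 'cV[R]_p) : R :=
  \sum_(i < p) x i 0 * y i 0.

(* The norm `|x| that the library puts on matrices is the sup norm. *)
Definition enorm {R : realType} {p : nat} (x : 'cV[R]_p) : R :=
  Num.sqrt (dot x x).

Definition metric_proj {R : realType} {p : nat} (S : set 'cV[R]_p)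
    (z : 'cV[R]_p) : set 'cV[R]_p :=
  [set s | S s /\ forall t, S t -> enorm (s - z) <= enorm (t - z)].

Definition set_comp {X Y Z : Type} (G : Y -> set Z) (F : X -> set Y) (x : X) :
    set Z :=
  \bigcup_(y in F x) G y.

Definition K1 {R : realType} : set (R * R) :=
  [set ab | ab.2 < ab.1 \/ (ab.1 = ab.2 /\ ab.2 <= 0)].

Definition K2 {R : realType} : set (R * R) :=
  [set ab | ab.1 < ab.2 \/ (ab.1 = ab.2 /\ ab.2 <= 0)].

Definition psi {R : realType} (s t : R) : R :=
  2^-1 * Num.min s t ^+ 2 + 2^-1 * Num.max (- Num.max s t) 0 ^+ 2.

Definition Psi {R : realType} {n : nat} (w : 'cV[R]_(n + n)) : R :=
  \sum_(i < n) psi (usubmx w i 0) (dsubmx w i 0).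

Definition Tmx {R : realType} {m n : nat} (A B : 'M[R]_(m, n)) :
    'M[R]_(m, n + n) :=
  row_mx (A + B) (- A + B).

Definition C1 {R : realType} {m n : nat} (A B : 'M[R]_(m, n)) (c : 'cV[R]_m) :
    set 'cV[R]_(n + n) :=
  [set w | Tmx A B *m w = Num.sqrt 2 *: c].

Definition C2 {R : realType} {n : nat} : set 'cV[R]_(n + n) :=
  [set w | [/\ forall i, 0 <= usubmx w i 0,
               forall i, 0 <= dsubmx w i 0
             & dot (usubmx w) (dsubmx w) = 0]].

Definition I1 {R : realType} {n : nat} (w : 'cV[R]_(n + n)) : set 'I_n :=
  [set i | usubmx w i 0 > dsubmx w i 0 /\ dsubmx w i 0 = 0].

Definition I2 {R : realType} {n : nat} (w : 'cV[R]_(n + n)) : set 'I_n :=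
  [set i | 0 = usubmx w i 0 /\ usubmx w i 0 < dsubmx w i 0].

Definition Gamma {R : realType} {n : nat} (wstar : 'cV[R]_(n + n)) :
    set 'cV[R]_(n + n) :=
  [set w | (forall i, I1 wstar i -> K1 (usubmx w i 0, dsubmx w i 0)) /\
           (forall i, I2 wstar i -> K2 (usubmx w i 0, dsubmx w i 0))].

(* Main.v *)
Require Import Defs.
From mathcomp Require Import all_boot all_order all_algebra.
From mathcomp Require Import all_classical all_reals all_analysis.
From mathcomp Require Import ring lra.

Import Order.TTheory GRing.Theory Num.Theory.
Import numFieldNormedType.Exports.

Local Open Scope classical_set_scope.
Local Open Scope ring_scope.

(** Idea of the proof. The iteration is Fejer monotone with respect to every
point z of the intersection for which the iterate w lies in Gamma z: if y is a
nearest point of w in C2 and w' a nearest point of y in C1, then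

  |w' - z|^2 + 2 Psi w <= |w - z|^2.

Convexity of C1 gives |w' - z| <= |y - z|. For the nonconvex set C2, what is
needed is that the angle at y between w and z is not acute; C2 is a product of
n copies of the planar cone formed by the two nonnegative half-axes, and in each
plane the only bad configuration is y on one half-axis and z strictly inside
the other one. Membership in K1 or K2, which is what Gamma z imposes, forces y
onto the half-axis of z ([planar_obtuse], [metric_proj_C2_obtuse]). By the
law of cosines |y - z|^2 + |w - y|^2 <= |w - z|^2, and 2 Psi w is at most the
squared distance |w - y|^2 ([Psi_le_dist]). This is [fejer_step].

Applied to wstar, it makes |w k - wstar|^2 eventually nonincreasing with
decrements at least 2 Psi (w k). Hence Psi (w k) tends to 0, and the iterates
are bounded, so they have a cluster point wbar. It lies in C1 because the
iterates do, and in C2 because Psi is continuous and vanishes only on C2.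

Staying in Gamma wstar does not by itself keep the iterates in Gamma wbar: wbar
may have nonzero coordinates where wstar has none. But Gamma wbar is a neighbourhood
of wbar ([Gamma_nbhs]), since the strict inequalities that hold at wbar persist
nearby. An iterate entering a small ball around wbar is thus in Gamma wbar,
[fejer_step] with z = wbar keeps the next iterate at least as close, and the
sequence never leaves the ball; as wbar is a cluster point, such entries occur
for arbitrarily small balls, so the whole sequence converges to wbar. *)

(** * Projection onto the union of the two nonnegative half-axes *)

Section Planar.
Context {R : realType}.
Implicit Types s t a b : R.

Definition complementary a b := [/\ 0 <= a, 0 <= b & a * b = 0].

Definition planar_nearest s t a b :=
  complementary a b /\ forall a' b', complementary a' b' ->
    (a - s) ^+ 2 + (b - t) ^+ 2 <= (a' - s) ^+ 2 + (b' - t) ^+ 2.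

Lemma complementaryC a b : complementary a b -> complementary b a.
Proof. by case=> a0 b0 ab; split=> //; rewrite mulrC. Qed.

Lemma complementary_axis a : 0 <= a -> complementary a 0.
Proof. by move=> a0; split=> //; rewrite mulr0. Qed.

Lemma complementary_cases a b : complementary a b ->
  (0 <= a /\ b = 0) \/ (0 <= b /\ a = 0).
Proof.
by case=> a0 b0 /eqP; rewrite mulf_eq0 => /orP[] /eqP ->; [right|left].
Qed.

Lemma planar_nearestC {s t a b} :
  planar_nearest s t a b -> planar_nearest t s b a.
Proof.
move=> [/complementaryC ba min]; split=> // a' b' /complementaryC /min.
by rewrite addrC [leRHS]addrC.
Qed.

(** The competitor is the nearest point of the half-axis itself. *)
Lemma planar_nearest_axis s t a : planar_nearest s t a 0 -> a = Num.max s 0.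
Proof.
move=> [[a0 _ _] min].
have m0 : 0 <= Num.max s 0 by rewrite le_max lexx orbT.
have := min _ _ (complementary_axis _ m0); rewrite lerD2r.
case: (leP s 0) => s0; nra.
Qed.

Lemma same_axis_obtuse s t a z :
  planar_nearest s t a 0 -> 0 <= z ->
  (s - a) * (z - a) + (t - 0) * (0 - 0) <= 0.
Proof. by move=> /planar_nearest_axis ->; case: (leP s 0) => s0 z0; nra. Qed.

(** Were a positive, s would equal a and t would be larger, so (0, t), at squared
distance s^2, would beat (a, 0), at squared distance t^2. *)
Lemma planar_nearest_above_diag s t a : planar_nearest s t a 0 -> s < t -> a = 0.
Proof.
move=> near st; have := planar_nearest_axis _ _ _ near.
case: (leP s 0) => // s0 as_.
have [_ /(_ 0 t)] := near.
have /(complementary_axis _)/complementaryC tc : 0 <= t by lra.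
move=> /(_ tc); rewrite as_; nra.
Qed.

(** When z is strictly inside the second half-axis, K2 excludes the projections
onto the first half-axis except the origin, which is nearest to (s, t) only if
t <= 0; the inner product is then t * z. *)
Lemma cross_axis_obtuse s t a z :
  planar_nearest s t a 0 -> 0 <= z -> (0 < z -> K2 (s, t)) ->
  (s - a) * (0 - a) + (t - 0) * (z - 0) <= 0.
Proof.
move=> near; rewrite le_eqVlt => /orP[/eqP <- _|z0 /(_ z0) K].
  exact: same_axis_obtuse near _.
have a0 : a = 0.
  case: K => /= [|[st t0]]; first exact: planar_nearest_above_diag.
  by rewrite (planar_nearest_axis _ _ _ near) st max_r.
have t0 : t <= 0.
  have [_ min] := near.
  have m0 : 0 <= Num.max t 0 by rewrite le_max lexx orbT.
  have := min _ _ (complementaryC _ _ (complementary_axis _ m0)); rewrite a0.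
  case: (leP t 0) => //; nra.
by rewrite a0; nra.
Qed.

(** Convexity is missing, but an obtuse angle at the projection is recovered as
soon as the projection lands on the half-axis that contains z; all
nearest points of a point of K1, respectively K2, are on the first, respectively
the second, half-axis. *)
Lemma planar_obtuse {s t a b z1 z2} :
  planar_nearest s t a b -> complementary z1 z2 ->
  (0 < z1 -> K1 (s, t)) -> (0 < z2 -> K2 (s, t)) ->
  (s - a) * (z1 - a) + (t - b) * (z2 - b) <= 0.
Proof.
have swap (p q : R) : K1 (p, q) -> K2 (q, p).
  by case=> /= [|[-> ?]]; [left|right].
move=> near /complementary_cases z12 k1 k2.
have [[_ b0]|[_ a0]] := complementary_cases _ _ (proj1 near); subst.
  case: z12 => -[z0 e]; subst; first exact: same_axis_obtuse near _.
  exact: cross_axis_obtuse near _ _.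
rewrite addrC; case: z12 => -[z0 e]; subst.
  apply: cross_axis_obtuse (planar_nearestC near) _ _ => //.
  by move=> /k1 /swap.
exact: same_axis_obtuse (planar_nearestC near) _.
Qed.

Lemma psi_ge0 s t : 0 <= psi s t.
Proof. by rewrite /psi addr_ge0 // mulr_ge0 ?sqr_ge0 ?invr_ge0. Qed.

(** The first term of psi forces the smaller of the two numbers to be 0, and the
second forces the larger one to be nonnegative. *)
Lemma psi_eq0 s t : psi s t = 0 -> complementary s t.
Proof.
rewrite /psi; case: (leP s t) => st.
  case: (leP (- t) 0) => t0 h; have s0 : s = 0 by nra.
  - by rewrite s0; split; [|lra|rewrite mul0r].
  - by exfalso; nra.
case: (leP (- s) 0) => s0 h; have t0 : t = 0 by nra.
- by rewrite t0; split; [lra| |rewrite mulr0].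
- by exfalso; nra.
Qed.

Lemma psi_double s t :
  2 * psi s t = Num.min s t ^+ 2 + Num.max (- Num.max s t) 0 ^+ 2.
Proof. by rewrite /psi -mulrDr mulVKf ?pnatr_eq0. Qed.

Lemma psiC s t : psi s t = psi t s.
Proof. by rewrite /psi (minC s) (maxC s). Qed.

(** psi is half the squared distance to the pair of half-axes. Exchanging the coordinates reduces to a point
of the first half-axis, whose squared distance from (s, t) is at least t^2, and
at least s^2 + t^2 if s <= 0. *)
Lemma psi_le_dist s t {a b} : complementary a b ->
  2 * psi s t <= (s - a) ^+ 2 + (t - b) ^+ 2.
Proof.
wlog b0 : s t a b / b = 0 => [wl ab|].
  have [[_ b0]|[_ a0]] := complementary_cases _ _ ab; first exact: wl ab.
  by rewrite psiC addrC; apply: wl (complementaryC _ _ ab).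
rewrite psi_double b0 subr0 => -[a0 _ _].
have neg (r : R) : r <= 0 -> r ^+ 2 <= (r - a) ^+ 2 by move=> r0; nra.
case: (leP s t) => st.
  have [t0|t0] := leP (- t) 0; last first.
    by rewrite sqrrN lerD2r neg //; lra.
  rewrite expr0n addr0; have [s0|s0] := leP s 0.
    by rewrite (le_trans (neg _ s0)) // lerDl sqr_ge0.
  by rewrite (@le_trans _ _ (t ^+ 2)) // ?lerDr ?sqr_ge0 //; nra.
rewrite addrC lerD2r; have [s0|s0] := leP (- s) 0.
  by rewrite expr0n sqr_ge0.
by rewrite sqrrN neg //; lra.
Qed.

End Planar.

(** * Euclidean geometry of column vectors *)

Section Euclid.
Context {R : realType} {p : nat}.
Implicit Types x y z : 'cV[R]_p.

Lemma dot_ge0 x : 0 <= dot x x.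
Proof. by apply: sumr_ge0 => i _; rewrite -expr2 sqr_ge0. Qed.

Lemma le_enorm x y : (enorm x <= enorm y) = (dot x x <= dot y y).
Proof. by rewrite /enorm ler_sqrt // dot_ge0. Qed.

Lemma dot_subC x y : dot (x - y) (x - y) = dot (y - x) (y - x).
Proof. by apply: eq_bigr => i _; rewrite !mxE; ring. Qed.

Lemma dot_expand (s : R) x y :
  dot (x + s *: y) (x + s *: y) = dot x x + 2 * s * dot x y + s ^+ 2 * dot y y.
Proof.
rewrite /dot !mulr_sumr -!big_split /=; apply: eq_bigr => i _.
by rewrite !mxE; ring.
Qed.

(** Links the Euclidean norm, in which the projections are taken, to the sup
norm, which defines the topology. *)
Lemma mx_norm_lt_sqr x (e : R) : 0 < e -> dot x x < e ^+ 2 -> `|x| < e.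
Proof.
move=> e0 xe; rewrite /Num.Def.normr /= mx_normrE.
apply: bigmax_lt => //= -[i j] _ /=; rewrite ord1.
rewrite -(@ltr_pXn2r _ 2) ?nnegrE ?normr_ge0 ?(ltW e0) //.
apply: le_lt_trans xe; rewrite real_normK ?num_real //.
rewrite /dot (bigD1 i) //= expr2 lerDl.
by apply: sumr_ge0 => k _; rewrite -expr2 sqr_ge0.
Qed.

(** Otherwise, moving from s towards z decreases the distance to y to first
order in the step length. *)
Lemma metric_proj_obtuse {S : set 'cV[R]_p} {y s z} :
  (forall x' y' (l : R), S x' -> S y' -> 0 <= l <= 1 ->
     S (x' + l *: (y' - x'))) ->
  metric_proj S y s -> S z -> dot (y - s) (z - s) <= 0.
Proof.
move=> cvx [Ss min] Sz.
have key (l : R) : 0 <= l <= 1 ->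
    2 * l * dot (y - s) (z - s) <= l ^+ 2 * dot (z - s) (z - s).
  move=> l01; have := min _ (cvx _ _ l Ss Sz l01).
  rewrite le_enorm dot_subC [leRHS]dot_subC opprD addrA -scaleNr dot_expand; lra.
have q0 := dot_ge0 (z - s).
set b := dot (y - s) _ in key *; set q := dot _ (z - s) in key q0.
rewrite leNgt; apply/negP => b0.
(* Any step below 2b/q contradicts minimality; b/(q + b) is one that also stays
   in [0, 1] and makes sense when q = 0. *)
have d0 : 0 < q + b by lra.
have l01 : 0 <= b / (q + b) <= 1.
  apply/andP; split; first by rewrite divr_ge0; lra.
  by rewrite ler_pdivrMr //; lra.
have := key _ l01; set l := b / _.
have lb : l * (q + b) = b by rewrite /l divfK // gt_eqF.
have l0 : 0 < l by rewrite divr_gt0.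
have lq : l * q = b - l * b by rewrite -[X in X - _]lb; ring.
have lb0 : 0 < l * b by rewrite mulr_gt0.
by rewrite expr2 -[leRHS]mulrA lq; nra.
Qed.

Lemma law_of_cosines y x z :
  dot (x - z) (x - z) =
  dot (x - y) (x - y) + dot (y - z) (y - z) - 2 * dot (x - y) (z - y).
Proof.
rewrite /dot mulr_sumr -sumrN -!big_split /=; apply: eq_bigr => i _.
by rewrite !mxE; ring.
Qed.

End Euclid.

(** * The two constraint sets and the merit function *)

Lemma dot_blocks {R : realType} {n : nat} (x y : 'cV[R]_(n + n)) :
  dot x y = \sum_(i < n) (usubmx x i 0 * usubmx y i 0 +
                          dsubmx x i 0 * dsubmx y i 0).
Proof.
by rewrite /dot big_split_ord /= -big_split; apply: eq_bigr => i _; rewrite !mxE.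
Qed.

Lemma blocksB {R : realType} {n : nat} (x y : 'cV[R]_(n + n)) i :
  (usubmx (x - y) i 0 = usubmx x i 0 - usubmx y i 0) *
  (dsubmx (x - y) i 0 = dsubmx x i 0 - dsubmx y i 0).
Proof. by rewrite !mxE. Qed.

Lemma C2P {R : realType} {n : nat} (w : 'cV[R]_(n + n)) :
  C2 w <-> forall i, complementary (usubmx w i 0) (dsubmx w i 0).
Proof.
split=> [[u0 v0 uv] i | cw].
  split=> //; apply/eqP; move/eqP: uv; rewrite /dot psumr_eq0.
    by move=> /allP /(_ i); rewrite mem_index_enum; apply.
  by move=> j _; rewrite mulr_ge0.
split=> [i|i|]; [by case: (cw i)..|].
by rewrite /dot big1 // => i _; case: (cw i).
Qed.

(** C2 is a product of planar cones, so its metric projector acts plane by plane: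
alter y in a single plane and compare. *)
Lemma metric_proj_C2_planar {R : realType} {n : nat} {w y : 'cV[R]_(n + n)} (i : 'I_n) :
  metric_proj C2 w y ->
  planar_nearest (usubmx w i 0) (dsubmx w i 0) (usubmx y i 0) (dsubmx y i 0).
Proof.
move=> [/C2P Cy min]; split=> // a b ab.
pose t : 'cV[R]_(n + n) :=
  col_mx (\col_j if j == i then a else usubmx y j 0)
         (\col_j if j == i then b else dsubmx y j 0).
have Ct : C2 t.
  apply/C2P => j; rewrite col_mxKu col_mxKd !mxE.
  by case: eqP => // _; have := Cy j; rewrite !mxE.
have := min t Ct; rewrite le_enorm !dot_blocks.
rewrite (bigD1 i) //= [leRHS](bigD1 i) //= !blocksB col_mxKu col_mxKd -!expr2.
rewrite ![(\col__ _) i 0]mxE eqxx.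
rewrite [X in _ <= _ + X](eq_bigr (fun j =>
  usubmx (y - w) j 0 * usubmx (y - w) j 0 +
  dsubmx (y - w) j 0 * dsubmx (y - w) j 0)) ?lerD2r // => j /negPf ji.
by rewrite !blocksB col_mxKu col_mxKd ![(\col__ _) j 0]mxE ji.
Qed.

Lemma convex_C1 {R : realType} {m n : nat} (A B : 'M[R]_(m, n)) (c : 'cV[R]_m)
    (x y : 'cV[R]_(n + n)) (l : R) :
  C1 A B c x -> C1 A B c y -> 0 <= l <= 1 -> C1 A B c (x + l *: (y - x)).
Proof.
rewrite /C1 /= => Tx Ty _.
by rewrite mulmxDr -scalemxAr mulmxBr Tx Ty subrr scaler0 addr0.
Qed.

Lemma metric_proj_C2_obtuse {R : realType} {n : nat} {w y z : 'cV[R]_(n + n)} :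
  metric_proj C2 w y -> C2 z -> Gamma z w -> dot (w - y) (z - y) <= 0.
Proof.
move=> Py /C2P Cz [g1 g2]; rewrite dot_blocks; apply: sumr_le0 => i _.
rewrite !blocksB; apply: (planar_obtuse (metric_proj_C2_planar i Py) (Cz i)) => zi.
  apply: g1; rewrite /I1 /=.
  by case: (complementary_cases _ _ (Cz i)) => -[_ e]; move: zi; rewrite e ?ltxx.
apply: g2; rewrite /I2 /=.
by case: (complementary_cases _ _ (Cz i)) => -[_ e]; move: zi; rewrite e ?ltxx.
Qed.

Lemma Psi_le_dist {R : realType} {n : nat} (w y : 'cV[R]_(n + n)) :
  C2 y -> 2 * Psi w <= dot (w - y) (w - y).
Proof.
move=> /C2P Cy; rewrite /Psi mulr_sumr dot_blocks; apply: ler_sum => i _.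
by rewrite !blocksB -!expr2 psi_le_dist.
Qed.

Lemma fejer_step {R : realType} {m n : nat} {A B : 'M[R]_(m, n)}
    {c : 'cV[R]_m} {w w' z : 'cV[R]_(n + n)} :
  set_comp (metric_proj (C1 A B c)) (metric_proj C2) w w' ->
  (C1 A B c `&` C2) z -> Gamma z w ->
  dot (w' - z) (w' - z) + 2 * Psi w <= dot (w - z) (w - z).
Proof.
move=> [y Py Pw'] [C1z C2z] Gw.
have := metric_proj_C2_obtuse Py C2z Gw.
have := metric_proj_obtuse (convex_C1 A B c) Pw' C1z.
have := Psi_le_dist w y (proj1 Py); have := dot_ge0 (y - w').
rewrite (law_of_cosines y w z) (law_of_cosines w' y z); lra.
Qed.

Lemma Psi_ge0 {R : realType} {n : nat} (w : 'cV[R]_(n + n)) : 0 <= Psi w.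
Proof. by apply: sumr_ge0 => i _; apply: psi_ge0. Qed.

Lemma Psi_eq0 {R : realType} {n : nat} (w : 'cV[R]_(n + n)) :
  Psi w = 0 -> C2 w.
Proof.
move=> /eqP; rewrite /Psi psumr_eq0 => [/allP w0|i _]; last exact: psi_ge0.
by apply/C2P => i; apply/psi_eq0/eqP/w0; rewrite mem_index_enum.
Qed.

(** * Topological tools *)

Lemma cluster_continuous {T U : topologicalType} {F : set_system T}
    {f : T -> U} {p : T} :
  {for p, continuous f} -> cluster F p -> cluster (f @ F) (f p).
Proof. by move=> fp Fp P Q FP /fp /(Fp _ _ FP)[x [Px Qx]]; exists (f x). Qed.

Lemma trmx_continuous {R : realType} {p q : nat} :
  continuous (@trmx R p q).
Proof.
move=> M s /= /(nbhs_ballP M^T) [e e0 es].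
apply/nbhs_ballP; exists e => //= N [_ MN]; apply: es; split=> // i j.
by rewrite !mxE.
Qed.

(** Bolzano-Weierstrass for column vectors; transposition carries the compactness
of boxes of row vectors over to them. *)
Lemma bounded_cluster {R : realType} {p : nat} (x : nat -> 'cV[R]_p) (M : R) :
  (\forall k \near \oo, `|x k| <= M) -> exists xbar, cluster (x @ \oo) xbar.
Proof.
move=> xM.
have box := rV_compact (fun=> @segment_compact R (- M) M).
have [|v [_ clv]] := box p ((fun k => (x k)^T) @ \oo) _.
  apply: filterS xM => k xkM i /=.
  rewrite /= in_itv /= mxE -ler_norml; apply: le_trans xkM.
  rewrite [leRHS]/Num.Def.normr /= mx_normrE.
  exact: (le_bigmax _ (fun ij => `|x k ij.1 ij.2|) (i, 0)).
exists v^T.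
rewrite (_ : x = trmx \o (fun k => (x k)^T)).
  exact: (cluster_continuous (trmx_continuous v) clv).
by apply/funext => k; rewrite /= trmxK.
Qed.

Lemma cvg_of_dist {R : realType} {p : nat} (x : nat -> 'cV[R]_p) (z : 'cV[R]_p) :
  (forall e, 0 < e -> \forall k \near \oo, dot (x k - z) (x k - z) < e) ->
  x k @[k --> \oo] --> z.
Proof.
move=> xz; apply/cvgrPdist_lt => e e0.
have /xz : 0 < e ^+ 2 by rewrite exprn_gt0.
by apply: filterS => k; rewrite distrC; apply: mx_norm_lt_sqr.
Qed.

Lemma dot_dist_continuous {R : realType} {p : nat} (z : 'cV[R]_p) :
  continuous (fun x : 'cV[R]_p => dot (x - z) (x - z)).
Proof.
apply: continuous_big => [|i _ x]; first exact: add_continuous.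
suff coord : {for x, continuous (fun x : 'cV[R]_p => (x - z) i 0)}.
  exact: continuousM.
rewrite (_ : (fun x : 'cV[R]_p => (x - z) i 0) =
    (fun x : 'cV[R]_p => x i 0 - z i 0)).
  by apply: continuousB; [exact: coord_continuous|exact: cst_continuous].
by apply/funext => y; rewrite !mxE.
Qed.

Lemma blocks_continuous {R : realType} {n : nat} (i : 'I_n) :
  continuous (fun w : 'cV[R]_(n + n) => usubmx w i 0) /\
  continuous (fun w : 'cV[R]_(n + n) => dsubmx w i 0).
Proof.
split=> w.
  rewrite (_ : (fun w : 'cV[R]_(n + n) => usubmx w i 0) =
    (fun w : 'cV[R]_(n + n) => w (lshift n i) 0)).
    exact: coord_continuous.
  by apply/funext => y; rewrite mxE.
rewrite (_ : (fun w : 'cV[R]_(n + n) => dsubmx w i 0) =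
    (fun w : 'cV[R]_(n + n) => w (rshift n i) 0)).
  exact: coord_continuous.
by apply/funext => y; rewrite mxE.
Qed.

Lemma Psi_continuous {R : realType} {n : nat} : continuous (@Psi R n).
Proof.
apply: continuous_big => [|i _ w]; first exact: add_continuous.
have [uc vc] := @blocks_continuous R n i.
have sq (f : 'cV[R]_(n + n) -> R) : {for w, continuous f} ->
    {for w, continuous (fun x => 2^-1 * f x ^+ 2)}.
  by move=> fc; apply: continuousM; [exact: cst_continuous|apply: continuousM].
have minc := sq _ (continuous_min (uc w) (vc w)).
have maxc := sq _ (continuous_max
  (continuousN (continuous_max (uc w) (vc w))) (@cst_continuous _ _ (0 : R) w)).
exact: continuousD minc maxc.
Qed.

(** The sequence u is eventually nonincreasing and bounded below, hence
convergent, and v is squeezed between 0 and its decrements. *)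
Lemma telescoping_cvg0 {R : realType} (u v : nat -> R) :
  (forall k, 0 <= u k) -> (forall k, 0 <= v k) ->
  (\forall k \near \oo, u k.+1 + v k <= u k) -> v k @[k --> \oo] --> 0.
Proof.
move=> u0 v0 [N _ uv].
have : cvgn [sequence u (n + N)%N]_n.
  apply: nonincreasing_is_cvgn; last by exists 0 => _ [k _ <-]; apply: u0.
  apply/nonincreasing_seqP => k /=; have := uv (k + N)%N (leq_addl _ _).
  by rewrite addSn; have := v0 (k + N)%N; lra.
move=> /cvg_ex[l]; rewrite cvg_shiftn => ul.
apply: (@squeeze_cvgr _ _ _ _ (fun=> 0) (fun k => u k - u k.+1)); last 2 first.
- exact: cvg_cst.
- by rewrite -(subrr l); apply: cvgB => //; rewrite cvg_shiftS.
by exists N => // k /uv; rewrite v0 /=; lra.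
Qed.

(** The conditions that define Gamma z concern the indices at which z has a
strict inequality between its two blocks; that strict inequality, which already
implies membership in K1 or K2, is an open condition. *)
Lemma Gamma_nbhs {R : realType} {n : nat} (z : 'cV[R]_(n + n)) :
  \forall x \near z, Gamma z x.
Proof.
have near1 := @filter_forall _ _
  (fun i x => I1 z i -> K1 (usubmx x i 0, dsubmx x i 0)) _ (nbhs_filter z).
have near2 := @filter_forall _ _
  (fun i x => I2 z i -> K2 (usubmx x i 0, dsubmx x i 0)) _ (nbhs_filter z).
apply: filterS2 (near1 _) (near2 _) => [x //|i|i];
  have [uc vc] := @blocks_continuous R n i;
  have dc := continuousB (uc z) (vc z).
  have [zi|nzi] := pselect (I1 z i); last by apply: nearW.
  have : 0 < usubmx z i 0 - dsubmx z i 0 by rewrite subr_gt0; case: zi.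
  by move=> /(cvgr_gt _ dc); apply: filterS => x /=; rewrite subr_gt0; left.
have [zi|nzi] := pselect (I2 z i); last by apply: nearW.
have : usubmx z i 0 - dsubmx z i 0 < 0 by rewrite subr_lt0; case: zi.
by move=> /(cvgr_lt _ dc); apply: filterS => x /=; rewrite subr_lt0; left.
Qed.

(** * Convergence of the alternating projections *)

Theorem theorem3p12 (R : realType) (m n : nat) (A B : 'M[R]_(m, n))
    (c : 'cV[R]_m) (w : nat -> 'cV[R]_(n + n))
    (hw : forall k : nat,
        set_comp (metric_proj (C1 A B c)) (metric_proj C2) (w k) (w k.+1))
    (wstar : 'cV[R]_(n + n))
    (hwstar : (C1 A B c `&` C2) wstar)
    (hGamma : \forall k \near \oo, Gamma wstar (w k)) :
  Psi (w k) @[k --> \oo] --> (0 : R) /\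
  exists wbar : 'cV[R]_(n + n),
    (C1 A B c `&` C2) wbar /\ w k @[k --> \oo] --> wbar.
Proof.
have wC1 k : C1 A B c (w k.+1) by have [y _ []] := hw k.
pose D z k := dot (w k - z) (w k - z).
have D0 z k : 0 <= D z k by exact: dot_ge0.
have P0 k : 0 <= 2 * Psi (w k) by rewrite mulr_ge0 ?Psi_ge0.
have fejer : \forall k \near \oo, D wstar k.+1 + 2 * Psi (w k) <= D wstar k.
  by apply: filterS hGamma => k; apply: fejer_step.
have Psi_cvg : Psi (w k) @[k --> \oo] --> (0 : R).
  have := cvgM (cvg_cst (2^-1 : R)) (telescoping_cvg0 _ _ (D0 wstar) P0 fejer).
  rewrite mulr0 (_ : _ \* _ = fun k => Psi (w k)); first exact.
  by apply/funext => k /=; rewrite mulKf ?pnatr_eq0.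
split=> //.
have [M wM] : exists M, \forall k \near \oo, `|w k| <= M.
  have [N _ decr] := fejer.
  have DN k : (N <= k)%N -> D wstar k <= D wstar N.
    elim: k => [|k IH]; first by rewrite leqn0 => /eqP ->.
    rewrite leq_eqVlt => /orP[/eqP -> //|]; rewrite ltnS => Nk.
    by have := decr k Nk; have := IH Nk; have := P0 k; rewrite /=; lra.
  exists (1 + D wstar N + `|wstar|); exists N => // k /= /DN kN.
  rewrite -[w k](subrK wstar) (le_trans (ler_normD _ _)) // lerD2r.
  apply/ltW/mx_norm_lt_sqr; first by have := D0 wstar N; lra.
  by apply: le_lt_trans kN _; have := D0 wstar N; nra.
(* Limits of continuous functions along the sequence are inherited by a cluster point. *)
have [wbar clw] := bounded_cluster w M wM.
have wbarC1 : C1 A B c wbar.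
  rewrite /C1 /=; apply/colP => i.
  have Tc : {for wbar, continuous (fun x : 'cV[R]_(n + n) => (Tmx A B *m x) i 0)}.
    rewrite (_ : (fun x : 'cV[R]_(n + n) => (Tmx A B *m x) i 0) =
        (fun x : 'cV[R]_(n + n) => \sum_j Tmx A B i j * x j 0)).
      apply: continuous_big => [|j _ x]; first exact: add_continuous.
      by apply: continuousM; [exact: cst_continuous|exact: coord_continuous].
    by apply/funext => x; rewrite mxE.
  apply/esym/Rhausdorff; apply: cvg_cluster (cluster_continuous Tc clw).
  rewrite -[X in X --> _]/((fun k => (Tmx A B *m w k) i 0) @ \oo).
  rewrite -cvg_shiftS; apply: cvg_near_cst; apply: nearW => k /=.
  by rewrite wC1.
have wbarC2 : C2 wbar.
  apply/Psi_eq0/esym/Rhausdorff.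
  exact: cvg_cluster (cluster_continuous (Psi_continuous _) clw).
(* Fejer monotonicity with respect to wbar holds inside the ball of radius r,
   and is self-sustaining from the first iterate K closer to wbar than d. *)
exists wbar; split=> //; apply: cvg_of_dist => e e0.
have /nbhs_ballP[r /= r0 rGamma] := Gamma_nbhs wbar.
have close x : dot (x - wbar) (x - wbar) < r ^+ 2 -> Gamma wbar x.
  move=> xr; apply: rGamma; rewrite mx_norm_ball /ball_ /= distrC.
  exact: mx_norm_lt_sqr.
pose d := Num.min e (r ^+ 2).
have d0 : 0 < d by rewrite lt_min e0 exprn_gt0.
have [K Kd] : exists K, D wbar K < d.
  have near : \forall x \near wbar, dot (x - wbar) (x - wbar) < d.
    apply: (cvgr_lt _ (dot_dist_continuous wbar wbar)).
    by rewrite subrr /dot big1 // => i _; rewrite mxE mul0r.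
  have wrange : (w @ \oo) (range w) by exists 0%N => // k _; exists k.
  by have [x [[k _ <-] xd]] := clw _ _ wrange near; exists k.
exists K => // k /=; suff : (K <= k)%N -> D wbar k < d.
  by move=> h /h; rewrite lt_min => /andP[].
elim: k => [|k IH]; first by rewrite leqn0 => /eqP <-.
rewrite leq_eqVlt => /orP[/eqP <- //|]; rewrite ltnS => /IH kd.
apply: le_lt_trans (kd); have := P0 k.
have /(fejer_step (hw k) (conj wbarC1 wbarC2)) : Gamma wbar (w k).
  by apply: close; move: kd; rewrite lt_min => /andP[].
by rewrite /D; lra.
Qed.
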